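(* Let $X$ be a set, let $\star$ and $\square$ be two $\vee$-compatible relations on $\mathbb{F}(X)$, and let $\mathbb{J}$ be a steady class of filters containing $\mathbb{F}_1$. Let $\mathcal{F}$ be a filter on $X$ (all filters $\mathcal{G}$ below are filters on $X$). (1) The following are equivalent: (i) $\mathcal{F}\in\mathbb{J}^\star$; (ii) for every $\mathcal{G}\in\mathbb{J}$ with $\mathcal{G}\#\mathcal{F}$, $\mathcal{F}\vee\mathcal{G}\in\mathbb{F}_1^\star$; (iii) for every $\mathcal{G}\in\mathbb{J}$ with $\mathcal{G}\#\mathcal{F}$, $\mathcal{F}\vee\mathcal{G}\in\mathbb{J}^\star$; (iv) for every $\mathcal{G}\in\mathbb{J}^{\star\star}$ with $\mathcal{G}\#\mathcal{F}$, $\mathcal{F}\vee\mathcal{G}\in\mathbb{J}^\star$. (2) The following are equivalent: (i) $\mathcal{F}\in\mathbb{J}^{\star\square}$; (ii) for every $\mathcal{G}\in\mathbb{J}^\star$ with $\mathcal{G}\#\mathcal{F}$, $\mathcal{F}\vee\mathcal{G}\in\mathbb{J}^{\star\star\square}$; (iii) for every $\mathcal{G}\in\mathbb{J}^\star$ with $\mathcal{G}\#\mathcal{F}$, $\mathcal{F}\vee\mathcal{G}\in\mathbb{F}_1^{\star\star\square}$; (iv) for every $\mathcal{G}\in\mathbb{J}^\star$ with $\mathcal{G}\#\mathcal{F}$, $\mathcal{F}\vee\mathcal{G}\in\mathbb{J}^{\square}$; (v) for every $\mathcal{G}\in\mathbb{J}^\star$ with $\mathcal{G}\#\mathcal{F}$,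 $\mathcal{F}\vee\mathcal{G}\in\mathbb{F}_1^{\square}$.
   Context: Filters are proper. $\mathbb{F}(X)$ is the set of filters on $X$. A class $\mathbb{J}$ of filters prescribes for each set $X$ a subset $\mathbb{J}(X)\subseteq\mathbb{F}(X)$. $\mathbb{F}_1$ is the class of principal filters $A^\uparrow=\{B\subseteq X: A\subseteq B\}$ ($A\neq\varnothing$). Two families of sets mesh, $\mathcal{F}\#\mathcal{G}$, if $F\cap G\ne\varnothing$ for all $F\in\mathcal{F}$, $G\in\mathcal{G}$. If filters $\mathcal{F},\mathcal{G}$ mesh, $\mathcal{F}\vee\mathcal{G}$ is the filter generated by $\{F\cap G: F\in\mathcal{F},G\in\mathcal{G}\}$. A symmetric relation $\star$ on $\mathbb{F}(X)$ is $\vee$-compatible (sup-compatible) if $\mathcal{F}\star\mathcal{G}$ whenever $\mathcal{F},\mathcal{G}$ do not mesh, and $\mathcal{F}\star(\mathcal{G}\vee\mathcal{H})\Rightarrow(\mathcal{F}\vee\mathcal{H})\star\mathcal{G}$ whenever $\mathcal{G}\#\mathcal{F}$ and $\mathcal{F}\#\mathcal{H}$ (and $\mathcal{G}\vee\mathcal{H}$ is defined, i.e. $\mathcal{G}\#\mathcal{H}$). The polar of a class is $\mathbb{J}^\star(X)=\{\mathcal{F}\in\mathbb{F}(X): \mathcal{F}\star\mathcal{G}\text{ for all }\mathcal{G}\in\mathbb{J}(X)\}$; iterated polars are read left to right: $\mathbb{J}^{\star\square}=(\mathbb{J}^\star)^\square$, $\mathbb{J}^{\star\star\square}=((\mathbb{J}^\star)^\star)^\square$.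 A class $\mathbb{J}$ is steady if $\mathcal{F}\vee\mathcal{H}\in\mathbb{J}(X)$ whenever $\mathcal{F},\mathcal{H}\in\mathbb{J}(X)$ and $\mathcal{F}\#\mathcal{H}$. *)

(* Defs.v *)
From mathcomp Require Import all_boot boolp classical_sets filter.

Set Implicit Arguments.
Unset Strict Implicit.
Unset Printing Implicit Defensive.

Local Open Scope classical_set_scope.

Section sup.
Variable X : Type.
Implicit Types F G H : pfilter_on X.

Lemma sup_proper F G : F `#` G ->
  ProperFilter (smallest (@Filter X) [set A `&` B | A in F & B in G]).
Proof.
move=> FG; apply: Build_ProperFilter => s0.
suff: filter_from [set AB | F AB.1 /\ G AB.2] (fun AB => AB.1 `&` AB.2) set0.
  by move=> [[A B] [/= FA GB] AB0]; have [x /AB0] := FG A B FA GB.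
apply: s0; split; last by move=> _ [A FA [B GB <-]]; exists (A, B).
apply: filter_from_filter.
  by exists (setT, setT); split; apply: filterT.
move=> [A B] [A' B'] [/= FA GB] [/= FA' GB'].
exists (A `&` A', B `&` B'); first by split; apply: filterI.
by move=> x /= [[? ?] [? ?]].
Qed.

(* The supremum of two filters is partial: it takes a proof of meshing, which
   makes the generated filter proper. *)
Definition sup_filter F G (FG : F `#` G) : pfilter_on X :=
  PFilterPack _ (sup_proper FG).

Definition sup_compatible (r : pfilter_on X -> pfilter_on X -> Prop) : Prop :=
  [/\ forall F G, r F G -> r G F,
      forall F G, ~ F `#` G -> r F G
    & forall F G H (GF : G `#` F) (FH : F `#` H) (GH : G `#` H),
        r F (sup_filter GH) -> r (sup_filter FH) G].

Definition polar (r : pfilter_on X -> pfilter_on X -> Prop)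
    (C : set (pfilter_on X)) : set (pfilter_on X) :=
  [set F | forall G, C G -> r F G].

End sup.

Definition filters_class := forall X : Type, set (pfilter_on X).

Definition principal_filters : filters_class := fun X =>
  [set F : pfilter_on X | exists2 A : set X, A !=set0 & pfilter F = globally A].
Arguments principal_filters : clear implicits.

Definition steady (J : filters_class) : Prop :=
  forall (X : Type) (F H : pfilter_on X) (FH : F `#` H),
    J X F -> J X H -> J X (sup_filter FH).

(* Main.v *)
Require Import Defs.
From mathcomp Require Import all_boot boolp classical_sets filter.

(** The engine is an exchange law: for a sup-compatible relation [r], a filter
    [H] can be moved from one side of [r] to the other,
    [r F (H \/ G) -> r (F \/ G) H], and since non-meshing filters are always
    related, only the case where [F], [G], [H] pairwise mesh matters
    ([compat_exchange]).  Two consequences carry everything.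

    - If suprema of members of [C] with [G] lie in [D], then suprema of members
      of the polar of [D] with [G] lie in the polar of [C] ([polar_sup]), since
      [(F \/ G) r H] is the exchanged form of [F r (H \/ G)].  With
      [C = D = J], steadiness makes [J^*] stable under suprema with [J].
      Feeding this back, with the roles of the two filters swapped, makes [J^*]
      stable under suprema with [J^**] ([polar_sup_bipolar]).  The second part
      then combines both: suprema of [C = J^**] with [J^*] lie in [D = J^*], so
      suprema of the [square]-polar of [J^*] with [J^*] lie in that of [J^**].

    - Conversely, if [T] is the coarsest filter [{X}], then [(F \/ G) r T]
      already gives [r F G], as [T \/ G = G] ([compat_of_sup_top]).  As [T] is
      principal, having [F \/ G] in the polar of [F_1] for all [G] in [C] puts
      [F] in the polar of [C] ([polar_of_sup_principal]).

    All remaining implications are the Galois connection facts that polars are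
    antitone and that a class is contained in its bipolar. *)

Local Open Scope classical_set_scope.

Section sup_theory.
Local Set Implicit Arguments.
Local Unset Strict Implicit.
Variable X : Type.
Implicit Types F G H : pfilter_on X.

Lemma pfilter_inj F G : pfilter F = pfilter G -> F = G.
Proof.
case: F => f pf; case: G => g pg /= fg.
by case: _ / fg pg => pg; congr PFilterPack; apply: Prop_irrelevance.
Qed.

Lemma sup_filterC F G (FG : F `#` G) (GF : G `#` F) :
  sup_filter FG = sup_filter GF.
Proof.
apply: pfilter_inj => /=; congr smallest.
by apply/seteqP; split=> _ [A FA [B GB <-]]; exists B => //; exists A => //;
  rewrite setIC.
Qed.

Lemma sub_sup_filterl F G (FG : F `#` G) : pfilter F `<=` sup_filter FG.
Proof.
move=> A FA S [_ sub]; apply: sub; exists A => //; exists setT; last by rewrite setIT.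
exact: filterT.
Qed.

Lemma sub_sup_filterr F G (FG : F `#` G) : pfilter G `<=` sup_filter FG.
Proof.
move=> A GA S [_ sub]; apply: sub; exists setT; first exact: filterT.
by exists A => //; rewrite setTI.
Qed.

Lemma sup_filter_least F G (FG : F `#` G) H :
  pfilter F `<=` H -> pfilter G `<=` H -> pfilter (sup_filter FG) `<=` H.
Proof.
move=> FH GH A; apply; split; first exact: _.
by move=> _ [B /FH HB [C /GH HC <-]]; apply: filterI.
Qed.

End sup_theory.

Section compatible.
Local Set Implicit Arguments.
Local Unset Strict Implicit.
Variables (X : Type) (r : pfilter_on X -> pfilter_on X -> Prop).
Hypothesis r_compat : sup_compatible r.
Implicit Types F G H : pfilter_on X.

Let rC F G : r F G -> r G F. Proof. by case: r_compat => + _ _; apply. Qed.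

(** If [H] misses [F] or [G], it also misses the finer [F \/ G], so the
    conclusion is automatic; the hypothesis may thus assume meshing. *)
Lemma compat_exchange F G H (FG : F `#` G) :
  (F `#` H -> forall HG : H `#` G, r F (sup_filter HG)) -> r (sup_filter FG) H.
Proof.
case: r_compat => _ r_nomesh r_sup hyp.
have [FH|nFH] := pselect (F `#` H); last first.
  by apply: r_nomesh => supH; apply: nFH => A B /(sub_sup_filterl FG); apply: supH.
have [HG|nHG] := pselect (H `#` G); last first.
  apply: r_nomesh => supH; apply: nHG; rewrite meetsC => A B.
  by move=> /(sub_sup_filterr FG); apply: supH.
by apply: (r_sup F H G _ FG HG); [rewrite meetsC|exact: hyp].
Qed.

(** The coarsest filter is neutral for suprema, so exchanging it with [F]
    turns [T r (F \/ G)] into [(T \/ G) r F], that is [G r F]. *)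
Lemma compat_of_sup_top F G T (FG : F `#` G) : pfilter T = globally setT ->
  r (sup_filter FG) T -> r F G.
Proof.
move=> TE /rC rT; apply: rC.
have T_full A x : pfilter T A -> A x by rewrite TE; apply.
have mesh_T H : T `#` H.
  move=> A B TA HB.
  by have [x Bx] := filter_ex HB; exists x; split=> //; apply: T_full.
have supTG : sup_filter (mesh_T G) = G.
  apply: pfilter_inj; apply/seteqP; split; last exact: sub_sup_filterr.
  apply: sup_filter_least => // A TA.
  by apply: filterS filterT => x _; apply: T_full.
rewrite -supTG; case: r_compat => _ _; apply; last exact: rT.
by rewrite meetsC.
Qed.

Lemma sub_polar (C D : set (pfilter_on X)) :
  C `<=` D -> polar r D `<=` polar r C.
Proof. by move=> CD F DF G /CD /DF. Qed.

Lemma sub_bipolar (C : set (pfilter_on X)) : C `<=` polar r (polar r C).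
Proof. by move=> F CF G /(_ F CF) /rC. Qed.

Lemma polar_sup (C D : set (pfilter_on X)) F G (FG : F `#` G) :
  (forall H, C H -> forall HG : H `#` G, D (sup_filter HG)) ->
  polar r D F -> polar r C (sup_filter FG).
Proof. by move=> CD DF H CH; apply: compat_exchange => _ HG; apply/DF/CD. Qed.

(** For [H] in [C], the filter [F \/ H] is still in the polar of [C], hence
    related to [G]; exchanging [H] then gives [(F \/ G) r H]. *)
Lemma polar_sup_bipolar {C : set (pfilter_on X)} :
  (forall F H (FH : F `#` H), C F -> C H -> C (sup_filter FH)) ->
  forall F G (FG : F `#` G),
  polar r C F -> polar r (polar r C) G -> polar r C (sup_filter FG).
Proof.
move=> C_steady F G FG CF CCG H CH.
have GF : G `#` F by rewrite meetsC.
rewrite (sup_filterC FG GF); apply: compat_exchange => _ HF.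
apply: CCG; have FH : F `#` H by rewrite meetsC.
rewrite (sup_filterC HF FH); apply: polar_sup CF => K CK KH.
exact: C_steady.
Qed.

(** A non-meshing [G] is related to [F] anyway, and for the others the
    principal filter of the whole space suffices; it is available because
    [X], carrying a proper filter, is nonempty. *)
Lemma polar_of_sup_principal (C : set (pfilter_on X)) F :
  (forall G, C G -> forall FG : F `#` G,
    polar r (principal_filters X) (sup_filter FG)) ->
  polar r C F.
Proof.
move=> hyp G CG; have [FG|nFG] := pselect (F `#` G); last first.
  by case: r_compat => _ + _; apply.
have [x _] : [set: X] !=set0 by apply: (@filter_ex _ F); apply: filterT.
have T_proper : ProperFilter (globally [set: X]).
  exact: (globally_properfilter (a := x)).
pose T := PFilterPack (globally [set: X]) T_proper.
apply: (@compat_of_sup_top F G T FG) => //; apply: hyp => //.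
by exists setT => //; exists x.
Qed.

End compatible.

Theorem theorem10 (X : Type)
    (star square : pfilter_on X -> pfilter_on X -> Prop)
    (star_compat : sup_compatible star) (square_compat : sup_compatible square)
    (J : filters_class) (J_steady : steady J)
    (F1_J : forall Y : Type, principal_filters Y `<=` J Y)
    (F : pfilter_on X) :
  let F1 := principal_filters X in
  [<-> polar star (J X) F;
       forall G : pfilter_on X, J X G -> forall FG : F `#` G,
         polar star F1 (sup_filter FG);
       forall G : pfilter_on X, J X G -> forall FG : F `#` G,
         polar star (J X) (sup_filter FG);
       forall G : pfilter_on X, polar star (polar star (J X)) G ->
         forall FG : F `#` G, polar star (J X) (sup_filter FG)]
  /\
  [<-> polar square (polar star (J X)) F;
       forall G : pfilter_on X, polar star (J X) G -> forall FG : F `#` G,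
         polar square (polar star (polar star (J X))) (sup_filter FG);
       forall G : pfilter_on X, polar star (J X) G -> forall FG : F `#` G,
         polar square (polar star (polar star F1)) (sup_filter FG);
       forall G : pfilter_on X, polar star (J X) G -> forall FG : F `#` G,
         polar square (J X) (sup_filter FG);
       forall G : pfilter_on X, polar star (J X) G -> forall FG : F `#` G,
         polar square F1 (sup_filter FG)].
Proof.
move=> F1; have F1J : F1 `<=` J X := F1_J X.
have J_sup := J_steady X.
split.
  have ii_i : (forall G, J X G -> forall FG : F `#` G,
      polar star F1 (sup_filter FG)) -> polar star (J X) F.
    exact: polar_of_sup_principal.
  tfae.
  - move=> JF G JG FG; apply: (polar_sup star_compat) JF => H /F1J JH HG.
    exact: J_sup.
  - move=> /ii_i JF G JG FG; apply: (polar_sup star_compat) JF => H JH HG.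
    exact: J_sup.
  - move=> iii; have JF : polar star (J X) F.
      by apply: ii_i => G JG FG; apply: sub_polar (iii G JG FG).
    by move=> G JJG FG; apply: (polar_sup_bipolar star_compat).
  - move=> iv; apply: ii_i => G JG FG.
    by apply: (sub_polar F1J); apply: iv; apply: (sub_bipolar star_compat).
have i_ii : polar square (polar star (J X)) F ->
    forall G, polar star (J X) G -> forall FG : F `#` G,
    polar square (polar star (polar star (J X))) (sup_filter FG).
  move=> JF G JG FG; apply: (polar_sup square_compat) JF => H JJH HG.
  have GH : G `#` H by rewrite meetsC.
  by rewrite (sup_filterC HG GH); apply: (polar_sup_bipolar star_compat).
have v_i : (forall G, polar star (J X) G -> forall FG : F `#` G,
    polar square F1 (sup_filter FG)) -> polar square (polar star (J X)) F.
  exact: polar_of_sup_principal.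
tfae=> //.
- move=> ii G JG FG; apply: sub_polar (ii G JG FG).
  by apply: sub_polar; apply: sub_polar.
- move=> iii G JG FG.
  suff JF : polar square (polar star (J X)) F.
    by apply: sub_polar (i_ii JF G JG FG); apply: (sub_bipolar star_compat).
  apply: v_i => H JH FH; apply: sub_polar (iii H JH FH).
  exact: (sub_bipolar star_compat).
- by move=> iv G JG FG; apply: sub_polar (iv G JG FG).
Qed.
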